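(* Let $p:X\to D$ be the 3-fold branched covering over the disk $D$ with two branch points $p_1,p_2$ modeled on $y^3=(z-p_1)(z-p_2)$, so that $X$ is a torus with one boundary component. Let $\beta:D\to D$ be the half Dehn twist interchanging $p_1$ and $p_2$. Let $a_1,b_1,c_1$ be the three lifts to $X$ of the path from $p_1$ to $p_2$, labelled by the sheets $a,b,c$. Then $\beta$ lifts to a self-homeomorphism $\tilde\beta$ of $X$ fixing $\partial X$ pointwise, and this lift (a ''$1/6$ Dehn twist'') satisfies $$\tilde\beta(a_1)=b_1^{-1},\qquad \tilde\beta(b_1)=c_1^{-1},\qquad \tilde\beta(c_1)=a_1^{-1},$$ where $a_1^{-1},b_1^{-1},c_1^{-1}$ denote the paths $a_1,b_1,c_1$ with reversed direction.
   Context: Take $D=\{z\in\mathbb C:|z|\le 1\}$, $p_1=-\tfrac12$, $p_2=\tfrac12$. Let arc $0$ be the segment from $-1$ to $p_1$, arc $1$ the segment from $p_1$ to $p_2$ (oriented from $p_1$ to $p_2$), and arc $2$ the segment from $p_2$ to $1$. The covering space $X$ (homeomorphic to $\{(z,y)\in D\times\mathbb C : y^3=(z-p_1)(z-p_2)\}$) is built by cut-and-paste from three copies (sheets) of $D$ called $a$, $b$, $c$, each cut along arcs $0$ and $2$. For a sheet $s\in\{a,b,c\}$ and $j\in\{0,2\}$ write $\overline{s_j}$ and $\underline{s_j}$ for the upper and lower sides of the cut along arc $j$ in sheet $s$ (the sides bordering the part of the sheet with positive, resp. negative, imaginary part). The gluings are $$\overline{a_2}\sim\underline{c_2},\quad \overline{c_2}\sim\underline{b_2},\quad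 \overline{b_2}\sim\underline{a_2},\qquad \overline{a_0}\sim\underline{b_0},\quad \overline{b_0}\sim\underline{c_0},\quad \overline{c_0}\sim\underline{a_0},$$ and $p:X\to D$ is the identity on each sheet. The paths $a_1,b_1,c_1$ are the copies of arc $1$ in sheets $a,b,c$. The half Dehn twist $\beta$ is the (counterclockwise) homeomorphism of $D$ fixing $\partial D$ pointwise given by $\beta(re^{i\theta})=re^{i(\theta+\pi)}$ for $0\le r\le \tfrac34$ and $\beta(re^{i\theta})=re^{i(\theta+4\pi(1-r))}$ for $\tfrac34\le r\le 1$; it interchanges $p_1$ and $p_2$ and reverses arc $1$. A lift of $\beta$ is a homeomorphism $\tilde\beta:X\to X$ with $p\circ\tilde\beta=\beta\circ p$. The term ''$1/6$ Dehn twist'' is a name for the lift $\tilde\beta$ having the stated properties (it restricts to a local half twist on each of the three sheets). *)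

(* Defs.v *)
From HB Require Import structures.
From Stdlib Require Import Relation_Operators.
From mathcomp Require Import all_boot all_order all_algebra generic_quotient.
From mathcomp Require Import all_classical all_reals all_analysis.
From mathcomp Require Import complex ring lra.

Set Implicit Arguments.
Unset Strict Implicit.
Unset Printing Implicit Defensive.

Import Order.TTheory GRing.Theory Num.Theory.
Import numFieldNormedType.Exports.
Import ComplexField.Normc.

Local Open Scope classical_set_scope.
Local Open Scope ring_scope.
Local Open Scope complex_scope.
Local Open Scope quotient_scope.

(* The usual topology of the complex plane, given by the modulus. *)
HB.instance Definition _ (R : realType) := PseudoPointedMetric.copy R[i] (R[i])^o.
HB.instance Definition _ (R : realType) := NormedModule.copy R[i] (R[i])^o.

Definition homeomorphism (T U : topologicalType) (f : T -> U) : Prop :=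
  continuous f /\
  exists g : U -> T, [/\ continuous g, cancel f g & cancel g f].

Section Disk.
Variable R : realType.

Definition closed_disk : set R[i] := [set z | `|z| <= 1].
Definition disk : topologicalType := set_type closed_disk.

Definition p1 : R[i] := (- 2^-1)%:C.
Definition p2 : R[i] := (2^-1)%:C.

Definition seg (u v : R[i]) (t : R) : R[i] := u + t%:C * (v - u).
Definition segment (u v : R[i]) : set R[i] := seg u v @` `[0, 1].

Definition arc0 : set R[i] := segment (- 1) p1.
Definition arc1 : set R[i] := segment p1 p2.
Definition arc2 : set R[i] := segment p2 1.

Definition cis (t : R) : R[i] := cos t +i* sin t.

Definition twist_angle (r : R) : R :=
  if r <= 3 / 4 then pi else 4 * pi * (1 - r).

(* Multiplying by cis rotates, so that no choice of an argument of z is needed;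
   half_twist_polar is the formula in polar coordinates. *)
Definition half_twist_fun (z : R[i]) : R[i] := z * cis (twist_angle (normc z)).

Lemma cisD (s t : R) : cis (s + t) = cis s * cis t.
Proof.
rewrite /cis cosD sinD; congr (_ +i* _).
by rewrite addrC [sin s * _]mulrC [X in _ + X]mulrC.
Qed.

Lemma normc_cis (t : R) : normc (cis t) = 1.
Proof. by rewrite /= cos2Dsin2 sqrtr1. Qed.

Lemma normc_real (r : R) : 0 <= r -> normc r%:C = r.
Proof. by move=> r0; rewrite /= expr0n /= addr0 sqrtr_sqr ger0_norm. Qed.

Lemma half_twist_polar (r t : R) : 0 <= r ->
  half_twist_fun (r%:C * cis t) = r%:C * cis (t + twist_angle r).
Proof.
move=> r0; rewrite /half_twist_fun normcM normc_cis mulr1 normc_real//.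
by rewrite cisD mulrA.
Qed.

Lemma half_twist_fun_disk (z : disk) : closed_disk (half_twist_fun (val z)).
Proof.
have := set_valP z; rewrite /closed_disk /= /half_twist_fun normrM => z1.
by rewrite [X in _ * X]normc_def /= cos2Dsin2 sqrtr1 mulr1.
Qed.

Definition half_twist (z : disk) : disk :=
  exist _ (half_twist_fun (val z)) (mem_set (half_twist_fun_disk z)).

End Disk.

Variant sheet := sheet_a | sheet_b | sheet_c.
HB.instance Definition _ := gen_eqMixin sheet.
HB.instance Definition _ := gen_choiceMixin sheet.

Variant side := upper | lower.
HB.instance Definition _ := gen_eqMixin side.
HB.instance Definition _ := gen_choiceMixin side.

(* The sheet across arc 2, resp. arc 0: the upper side of the cut in sheet s is
   glued to the lower side of the cut in sheet [across2 s], resp. [across0 s]. *)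
Definition across2 (s : sheet) : sheet :=
  match s with
  | sheet_a => sheet_c
  | sheet_c => sheet_b
  | sheet_b => sheet_a
  end.

Definition across0 (s : sheet) : sheet :=
  match s with
  | sheet_a => sheet_b
  | sheet_b => sheet_c
  | sheet_c => sheet_a
  end.

Section Cover.
Variable R : realType.

(* The cut disk is the union of its closed upper and lower halves, which meet
   only along arc 1; the points of the cuts then occur once on each side. *)
Definition half_disk (e : side) : set R[i] :=
  [set z | `|z| <= 1 /\
    match e with upper => 0 <= complex.Im z | lower => complex.Im z <= 0 end].

Definition piece (i : sheet * side) : topologicalType :=
  set_type (half_disk i.2).

Definition pieces : topologicalType := {i : sheet * side & piece i}.

Definition mk_point (s : sheet) (e : side) (z : R[i]) (hz : half_disk e z) :
  pieces := existT piece (s, e) (exist _ z (mem_set hz)).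

Variant glue_gen : pieces -> pieces -> Prop :=
  | glue_arc1 s z (hu : half_disk upper z) (hl : half_disk lower z) of
      arc1 z : glue_gen (mk_point s hu) (mk_point s hl)
  | glue_arc2 s z (hu : half_disk upper z) (hl : half_disk lower z) of
      arc2 z : glue_gen (mk_point s hu) (mk_point (across2 s) hl)
  | glue_arc0 s z (hu : half_disk upper z) (hl : half_disk lower z) of
      arc0 z : glue_gen (mk_point s hu) (mk_point (across0 s) hl).

Definition glued (x y : pieces) : bool := `[< clos_refl_sym_trans _ glue_gen x y >].

Lemma glued_refl : reflexive glued.
Proof. by move=> x; apply/asboolP; exact: rst_refl. Qed.

Lemma glued_sym : symmetric glued.
Proof. by move=> x y; apply/asboolP/asboolP; exact: rst_sym. Qed.

Lemma glued_trans : transitive glued.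
Proof.
by move=> y x z /asboolP xy /asboolP yz; apply/asboolP; exact: rst_trans yz.
Qed.

Definition glued_equiv := EquivRel glued glued_refl glued_sym glued_trans.

Definition cover_quot := {eq_quot glued_equiv}.
Definition branched_cover : topologicalType := quotient_topology cover_quot.

Definition to_cover (x : pieces) : branched_cover := \pi_cover_quot x.

Lemma piece_disk i (x : piece i) : closed_disk (val x).
Proof. by case: (set_valP x). Qed.

Definition pieces_proj (x : pieces) : disk R :=
  exist _ (val (projT2 x)) (mem_set (piece_disk (projT2 x))).

(* The value does not depend on the representative: see cover_proj_to_cover. *)
Definition cover_proj (x : branched_cover) : disk R := pieces_proj (repr x).

Lemma cover_proj_to_cover (x : pieces) :
  cover_proj (to_cover x) = pieces_proj x.
Proof.
rewrite /cover_proj /to_cover.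
have /eqmodP/asboolP := reprK (\pi_cover_quot x).
move: (repr _) => y; elim=> {x y} [x y []|x|x y _ ->|x y z _ -> _ ->] //;
  by move=> s z hu hl _; apply: val_inj.
Qed.

(* The boundary circle of the surface consists of the copies of the boundary
   circle of the disk in the three sheets. *)
Definition cover_boundary : set branched_cover :=
  [set x | `|val (cover_proj x) : R[i]| = 1].

Definition unit_interval : topologicalType := set_type `[(0 : R), 1].

Lemma rev_time_subproof (t : unit_interval) : [set` `[(0 : R), 1]] (1 - val t).
Proof.
have := set_valP t; rewrite /= !in_itv /= => /andP[t0 t1].
by rewrite subr_ge0 t1 lerBlDr lerDl t0.
Qed.

Definition reverse_path (T : Type) (g : unit_interval -> T) (t : unit_interval) : T :=
  g (exist _ (1 - val t) (mem_set (rev_time_subproof t))).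

Lemma arc1_half_disk (t : unit_interval) :
  half_disk upper (seg (p1 R) (p2 R) (val t)).
Proof.
have := set_valP t; rewrite /= in_itv /= => /andP[t0 t1].
have -> : seg (p1 R) (p2 R) (val t) = (val t - 2^-1)%:C.
  by rewrite /seg /p1 /p2 -rmorphB -rmorphM -rmorphD; congr (_%:C); lra.
split=> //; rewrite normc_def /= expr0n addr0 sqrtr_sqr lecR ler_norml.
by apply/andP; split; lra.
Qed.

(* For sheets a, b, c these are the paths a_1, b_1, c_1; the upper and lower
   copies of arc 1 in a sheet agree by glue_arc1. *)
Definition arc1_lift (s : sheet) (t : unit_interval) : branched_cover :=
  to_cover (mk_point s (arc1_half_disk t)).

Definition is_lift (h : disk R -> disk R)
    (f : branched_cover -> branched_cover) : Prop :=
  homeomorphism f /\ cover_proj \o f = h \o cover_proj.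

End Cover.

(* Main.v *)
Require Import Defs.
From Stdlib Require Import Relation_Operators.
From mathcomp Require Import all_boot all_order all_algebra generic_quotient.
From mathcomp Require Import all_classical all_reals all_analysis.
From mathcomp Require Import complex ring lra.

Set Implicit Arguments.
Unset Strict Implicit.
Unset Printing Implicit Defensive.

Import Order.TTheory GRing.Theory Num.Theory.
Import numFieldNormedType.Exports.
Import ComplexField.Normc.

Local Open Scope classical_set_scope.
Local Open Scope ring_scope.
Local Open Scope complex_scope.
Local Open Scope quotient_scope.

(** Write X for the cover, s for a sheet, e for a side (upper or lower), and
    call half-disk e the closed half of the disk on that side.  X is six
    half-disks, one for each pair of a sheet and a side, glued along the
    diameter.

    Let sigma be the cyclic permutation a -> b -> c -> a.  Going
    counterclockwise around the annulus outside arc 1, one leaves the upper half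
    of sheet s through arc 0 and the lower half of sheet s through arc 2, and in
    both cases one arrives in sheet sigma s: the gluing along arc 2 is the
    inverse of the one along arc 0, but it is crossed from the lower side to the
    upper one ([chart_cut]).  The half twist rotates the circle of radius r
    counterclockwise by an angle phi(r), where phi = pi for r <= 3/4 and phi
    decreases to 0 at r = 1.  The lift that is the identity on the boundary
    turns each point along the annulus and changes the sheet when a cut is
    passed: in polar coordinates (r, t) of a half-disk, with 0 <= t <= pi, the
    point stays in its half-disk if t + phi(r) <= pi, and otherwise it passes to
    the other side in sheet sigma s.  In the inner disk phi = pi, so every point
    z is sent to - z on the other side in sheet sigma s.  That rule makes sense
    across arc 1 too, because the two halves of sheet s go to the two halves of
    the same sheet sigma s.  In particular arc 1 of sheet s goes to arc 1 of
    sheet sigma s, reversed.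

    These formulas agree under the gluings ([twist_chart_arc1],
    [twist_chart_cut]), so they define a map of X.  It is continuous because on
    each half-disk the two formulas hold on two closed sets and agree on the
    overlap: there t + phi(r) = pi, the image is on a cut, and the gluing
    identifies the two values ([twist_chart_continuous]).

    Complex conjugation reverses the half twist into its inverse, and it lifts
    to an involution J of X that exchanges the sides and the sheets b and c.
    Since J twist J twist is the identity ([mirror_twistK]), the lift is
    invertible with the continuous inverse J twist J. *)

(** * Continuity in the plane *)

Section Plane.
Variable R : realType.
Implicit Types (z w : R[i]) (r t : R).

Lemma normE z : `|z| = (normc z)%:C.
Proof. by case: z. Qed.

Lemma nonexpansive_continuous (f : R[i] -> R) :
  (forall z w, `|f z - f w| <= normc (z - w)) -> continuous f.
Proof.
move=> fle z; apply/(@cvgrPdist_lt _ R^o _ (nbhs z) (nbhs_filter z)) => e e0.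
have : \forall w \near z, ball z e%:C w by apply: nbhsx_ballx; rewrite ltcR.
apply: filterS => w; rewrite /ball/= normE ltcR.
by apply: le_lt_trans; exact: fle.
Qed.

Lemma Re_continuous : continuous (@complex.Re R : R[i] -> R).
Proof.
apply: nonexpansive_continuous => -[a b] [c d] /=.
by rewrite -sqrtr_sqr ler_wsqrtr// lerDl sqr_ge0.
Qed.

Lemma Im_continuous : continuous (@complex.Im R : R[i] -> R).
Proof.
apply: nonexpansive_continuous => -[a b] [c d] /=.
by rewrite -sqrtr_sqr ler_wsqrtr// lerDr sqr_ge0.
Qed.

Lemma normc_continuous : continuous (@normc R : R[i] -> R).
Proof.
apply: nonexpansive_continuous => z w; rewrite -lecR.
have : `| `|z| - `|w| | <= `|z - w| :> R[i] by exact: ler_dist_dist.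
by rewrite (normE z) (normE w) -rmorphB !normE/= expr0n addr0 sqrtr_sqr.
Qed.

(** The complex plane carries the topology of its modulus, not a product
    topology, so continuity of both coordinates has to be combined by the
    triangle inequality. *)
Lemma complex_continuous (T : topologicalType) (f g : T -> R) :
  continuous f -> continuous g -> continuous (fun x => f x +i* g x : R[i]).
Proof.
move=> cf cg x; apply/(@cvgrPdist_lt _ R[i] _ (nbhs x) (nbhs_filter x)) => e e0.
(* A complex number e with 0 < e is real. *)
have ee : e = (complex.Re e)%:C.
  by move: e0; rewrite ltcE/= => /andP[/eqP]; case: e => a b /= ->.
have e2 : 0 < complex.Re e / 2.
  by rewrite divr_gt0//; move: e0; rewrite ee ltcR.
near=> y.
have -> : f x +i* g x - (f y +i* g y) =
    (f x - f y)%:C + 'i * (g x - g y)%:C :> R[i].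
  by apply/eqP; rewrite eq_complex/=; apply/andP; split; apply/eqP; ring.
apply: (le_lt_trans (ler_normD _ _)); rewrite normrM normCi mul1r.
rewrite !normE/= expr0n !addr0 !sqrtr_sqr -rmorphD ee ltcR.
rewrite [ltRHS]splitr; apply: ltrD.
  by near: y; apply: (@cvgr_dist_lt _ R^o) => //; exact: cf.
by near: y; apply: (@cvgr_dist_lt _ R^o) => //; exact: cg.
Unshelve. all: by end_near.
Qed.

(** The two branches cross at r = 3/4, so the case distinction is a minimum;
    this gives the continuity of the angle. *)
Lemma twist_angle_min r : twist_angle r = Num.min pi (4 * pi * (1 - r)).
Proof.
rewrite /twist_angle; have pi0 := pi_gt0 R.
case: ifPn => r34; rewrite minEle; case: ifPn => // h; first by nra.
by nra.
Qed.

Lemma twist_angle_continuous : continuous (@twist_angle R).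
Proof.
rewrite (_ : @twist_angle R = fun r => Num.min pi (4 * pi * (1 - r))).
  move=> r; apply: (@continuous_min _ _ (cst pi) (fun r => 4 * pi * (1 - r))).
    exact: cvg_cst.
  apply: cvgM; [exact: cvg_cst|apply: cvgB; [exact: cvg_cst|exact: cvg_id]].
by apply/funext => r; rewrite twist_angle_min.
Qed.

Lemma half_twist_fun_continuous : continuous (@half_twist_fun R).
Proof.
pose phi z : R := twist_angle (normc z).
have cphi : continuous phi.
  by move=> z; apply: continuous_comp;
    [exact: normc_continuous|exact: twist_angle_continuous].
have ccos : continuous (cos \o phi : R[i] -> R).
  by move=> z; apply: continuous_comp; [exact: cphi|exact: continuous_cos].
have csin : continuous (sin \o phi : R[i] -> R).
  by move=> z; apply: continuous_comp; [exact: cphi|exact: continuous_sin].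
rewrite (_ : @half_twist_fun R = fun z =>
  (complex.Re z * cos (phi z) - complex.Im z * sin (phi z))
  +i* (complex.Re z * sin (phi z) + complex.Im z * cos (phi z))).
  apply: complex_continuous => z.
    apply: (@continuousB _ R^o _ (fun z => complex.Re z * cos (phi z))
      (fun z => complex.Im z * sin (phi z))).
      by apply: continuousM; [exact: Re_continuous|exact: ccos].
    by apply: continuousM; [exact: Im_continuous|exact: csin].
  apply: (@continuousD _ R^o _ (fun z => complex.Re z * sin (phi z))
    (fun z => complex.Im z * cos (phi z))).
    by apply: continuousM; [exact: Re_continuous|exact: csin].
  by apply: continuousM; [exact: Im_continuous|exact: ccos].
by apply/funext => -[x y].
Qed.

Lemma conjc_continuous : continuous (@conjc R : R[i] -> R[i]).
Proof.
rewrite (_ : @conjc R = fun z => complex.Re z +i* - complex.Im z).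
  apply: complex_continuous; first exact: Re_continuous.
  move=> z; apply: (@continuousN _ R^o _ (@complex.Im R)).
  exact: Im_continuous.
by apply/funext => -[].
Qed.

End Plane.

(** * Sheets and sides *)

Definition other_side (e : side) : side :=
  match e with upper => lower | lower => upper end.

Lemma other_sideK : involutive other_side.
Proof. by case. Qed.

(** Rotation by pi exchanges the two half-disks: multiplying both coordinates
    by this sign brings the lower half-disk to the upper one, so that one
    argument covers both sides. *)
Definition side_sign (R : realType) (e : side) : R :=
  match e with upper => 1 | lower => -1 end.

(** Reflecting the disk reverses the sense in which the cuts are crossed, so its
    lift needs a permutation of the sheets conjugating across0 to its inverse;
    see across0_swap. *)
Definition swap_bc (s : sheet) : sheet :=
  match s with
  | sheet_a => sheet_a
  | sheet_b => sheet_c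
  | sheet_c => sheet_b
  end.

Lemma swap_bcK : involutive swap_bc.
Proof. by case. Qed.

Lemma across0_swap s : across0 (swap_bc (across0 s)) = swap_bc s.
Proof. by case: s. Qed.

Lemma across0K : cancel across0 across2.
Proof. by case. Qed.

Lemma across2K : cancel across2 across0.
Proof. by case. Qed.

(** * Charts of the cover *)

Section Charts.
Variable R : realType.
Implicit Types (s : sheet) (e : side) (z w : R[i]).

Local Notation X := (branched_cover R).
Local Notation sg := (side_sign R).

Lemma side_sign_other e : sg (other_side e) = - sg e.
Proof. by rewrite /side_sign; case: e => //=; rewrite opprK. Qed.

Lemma half_diskE e z :
  half_disk e z <-> normc z <= 1 /\ 0 <= sg e * complex.Im z.
Proof.
rewrite /half_disk/= normE lecR /side_sign; case: e => /=; rewrite ?mul1r//.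
by rewrite mulN1r oppr_ge0.
Qed.

Lemma segment_realE (a b : R) z : a < b ->
  segment a%:C b%:C z <-> complex.Im z = 0 /\ a <= complex.Re z <= b.
Proof.
move=> ab; have ba : 0 < b - a by rewrite subr_gt0.
split=> [[t /=]|[]].
  rewrite in_itv/= => /andP[t0 t1] <-.
  rewrite /seg -rmorphB -rmorphM -rmorphD/=; split=> //; apply/andP; split; nra.
case: z => x y /= -> /andP[ax xb]; exists ((x - a) / (b - a)).
  rewrite /= in_itv/= divr_ge0 ?subr_ge0 ?(ltW ab)//= ler_pdivrMr// mul1r.
  by rewrite lerB.
by rewrite /seg -rmorphB -rmorphM -rmorphD/= divfK ?gt_eqF// subrKC.
Qed.

Lemma half_disk0 e : half_disk e (0 : R[i]).
Proof. by apply/half_diskE; rewrite /= expr0n addr0 sqrtr0 mulr0. Qed.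

(** The copy of half-disk e in sheet s, as a total function of z so that it can
    be composed with maps of the plane.  Outside the half-disk the value is an
    arbitrary point, namely the copy of 0. *)
Definition chart s e z : X :=
  match pselect (half_disk e z) with
  | left h => to_cover (mk_point s h)
  | right _ => to_cover (mk_point s (half_disk0 e))
  end.

Lemma chartE s e z (h : half_disk e z) : chart s e z = to_cover (mk_point s h).
Proof.
by rewrite /chart; case: pselect => // h'; rewrite (Prop_irrelevance h' h).
Qed.

Lemma to_coverE (x : pieces R) :
  to_cover x = chart (projT1 x).1 (projT1 x).2 (val (projT2 x)).
Proof.
case: x => -[s e] [z hz] /=; rewrite (chartE s (set_mem hz)).
by congr (to_cover (existT _ _ (exist _ _ _))); exact: bool_irrelevance.
Qed.

Lemma coverP (x : X) : exists s e z, half_disk e z /\ x = chart s e z.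
Proof.
have <- : to_cover (repr x) = x by rewrite /to_cover reprK.
rewrite to_coverE; case: (repr x) => -[s e] [z hz] /=.
by exists s, e, z; split=> //; exact: set_mem.
Qed.

Lemma cover_proj_chart s e z : half_disk e z ->
  val (cover_proj (chart s e z)) = z.
Proof. by move=> h; rewrite (chartE s h) cover_proj_to_cover. Qed.

Lemma to_cover_glue (x y : pieces R) : glue_gen x y -> to_cover x = to_cover y.
Proof. by move=> xy; apply/eqmodP/asboolP; exact: rst_step. Qed.

Definition on_arc1 z := complex.Im z = 0 /\ `|complex.Re z| <= 2^-1.

(** The cut that ends half-disk e in the counterclockwise direction: arc 0 for
    the upper half, arc 2 for the lower half. *)
Definition on_cut e z :=
  complex.Im z = 0 /\ 2^-1 <= - (sg e * complex.Re z) <= 1.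

Lemma arc1E z : arc1 z <-> on_arc1 z.
Proof.
rewrite /arc1 /p1 /p2 segment_realE; last by lra.
by rewrite /on_arc1 ler_norml.
Qed.

Lemma arc0E z : arc0 z <-> on_cut upper z.
Proof.
rewrite /arc0 /p1 (_ : -1 = (-1)%:C :> R[i]); last by rewrite rmorphN1.
rewrite segment_realE; last by lra.
by rewrite /on_cut /side_sign /= mul1r lerNr lerNl andbC.
Qed.

Lemma arc2E z : arc2 z <-> on_cut lower z.
Proof.
rewrite /arc2 /p2 (_ : 1 = 1%:C :> R[i])// segment_realE; last by lra.
by rewrite /on_cut /side_sign /= mulN1r opprK.
Qed.

Lemma normc_Im0 z : complex.Im z = 0 -> normc z = `|complex.Re z|.
Proof. by case: z => x y /= ->; rewrite expr0n addr0 sqrtr_sqr. Qed.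

Lemma on_arc1_half_disk e z : on_arc1 z -> half_disk e z.
Proof.
move=> [z0 zle]; apply/half_diskE; rewrite normc_Im0// z0 mulr0; split=> //.
by apply: (le_trans zle); lra.
Qed.

Lemma on_cut_half_disk e f z : on_cut e z -> half_disk f z.
Proof.
move=> [z0 zle]; apply/half_diskE; rewrite normc_Im0// z0 mulr0; split=> //.
rewrite ler_norml; move: zle; rewrite /side_sign.
by case: e => /=; lra.
Qed.

Lemma chart_arc1 s e f z : on_arc1 z -> chart s e z = chart s f z.
Proof.
move=> z1; have hu := on_arc1_half_disk upper z1.
have hl := on_arc1_half_disk lower z1.
have ul : chart s upper z = chart s lower z.
  rewrite (chartE s hu) (chartE s hl); apply: to_cover_glue.
  by apply: glue_arc1; apply/arc1E.
by case: e; case: f.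
Qed.

(** Leaving a half-disk counterclockwise always leads to sheet across0 s.  For
    the lower side this reads the gluing of arc 2 from its lower to its upper
    side, and across2 is inverse to across0. *)
Lemma chart_cut s e z : on_cut e z ->
  chart s e z = chart (across0 s) (other_side e) z.
Proof.
move=> zc; have hu := on_cut_half_disk upper zc.
have hl := on_cut_half_disk lower zc.
case: e zc => zc /=; rewrite (chartE _ hu) (chartE _ hl).
  by apply: to_cover_glue; apply: glue_arc0; apply/arc0E.
apply/esym; rewrite -{2}(across0K s).
by apply: to_cover_glue; apply: glue_arc2; apply/arc2E.
Qed.

(** A self-map of the cover is given by a formula F s e z on each half-disk,
    compatible with the gluings. *)
Section CoverMap.
Variable F : sheet -> side -> R[i] -> X.
Hypothesis F_arc1 : forall s z, on_arc1 z -> F s upper z = F s lower z.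
Hypothesis F_cut : forall s e z, on_cut e z ->
  F s e z = F (across0 s) (other_side e) z.

Definition pieces_map (x : pieces R) : X :=
  F (projT1 x).1 (projT1 x).2 (val (projT2 x)).

Definition cover_map (x : X) : X := pieces_map (repr x).

Lemma pieces_map_glued (x y : pieces R) : to_cover x = to_cover y ->
  pieces_map x = pieces_map y.
Proof.
move=> /eqmodP/asboolP; elim=> {x y} [x y []|x|x y _ ->|x y z _ -> _ ->] //.
- by move=> s z hu hl /arc1E; exact: F_arc1.
- by move=> s z hu hl /arc2E zc; rewrite /pieces_map/= [RHS]F_cut// across2K.
- by move=> s z hu hl /arc0E zc; rewrite /pieces_map/= F_cut.
Qed.

Lemma cover_mapE s e z : half_disk e z -> cover_map (chart s e z) = F s e z.
Proof.
move=> h; rewrite (chartE s h) /cover_map.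
by rewrite (@pieces_map_glued _ (mk_point s h))// /to_cover reprK.
Qed.

Lemma cover_map_continuous :
  (forall s e, {within half_disk e, continuous (F s e)}) ->
  continuous cover_map.
Proof.
move=> cF; apply: (@repr_comp_continuous _ (cover_quot R) X pieces_map).
  move=> [[s e] x] U; have /subspace_sigL_continuousP cse := cF s e.
  by move=> nU; apply: (@existT_continuous _ (@piece R)); exact: cse nU.
by move=> x y /eqP xy; apply/eqP; exact: pieces_map_glued.
Qed.

End CoverMap.

Lemma chart_continuous s e : {within half_disk e, continuous (chart s e)}.
Proof.
apply/subspace_sigL_continuousP.
rewrite (_ : sigL _ _ = (@to_cover R) \o existT (@piece R) (s, e)).
  move=> x; apply: continuous_comp; first exact: existT_continuous.
  exact: pi_continuous.
by apply/funext => x /=; rewrite to_coverE.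
Qed.

Lemma chart_comp_continuous (A : set R[i]) (h : R[i] -> R[i]) s e :
  continuous h -> (forall z, A z -> half_disk e (h z)) ->
  {within A, continuous (fun z => chart s e (h z))}.
Proof.
move=> ch hA; apply/subspace_continuousP => z Az.
have /subspace_continuousP cc := @chart_continuous s e.
move=> U /(cc _ (hA _ Az)) nU.
have {}nU : \forall w \near z, half_disk e (h w) -> U (chart s e (h w)).
  exact: ch z _ nU.
have : \forall w \near z, A w -> U (chart s e (h w)).
  by apply: filterS nU => w Uw Aw; apply: Uw; exact: hA.
by [].
Qed.

End Charts.

(** * Polar coordinates on the half-disks *)

Section Twist.
Variable R : realType.
Implicit Types (s : sheet) (e : side) (z w : R[i]) (r t : R).

Local Notation X := (branched_cover R).
Local Notation sg := (side_sign R).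

Lemma twist_angle_itv r : r <= 1 -> 0 <= twist_angle r <= pi.
Proof.
move=> r1; have pi0 := pi_gt0 R; rewrite twist_angle_min ge_min lexx/= andbT.
by rewrite le_min ltW//=; nra.
Qed.

Lemma twist_angle_inner r : r <= 3 / 4 -> twist_angle r = pi.
Proof. by rewrite /twist_angle => ->. Qed.

Lemma twist_angle1 : twist_angle 1 = 0 :> R.
Proof.
by rewrite /twist_angle subrr mulr0 ifF//; apply/negbTE; rewrite -ltNge; lra.
Qed.

(** Polar coordinates with the angle measured from the start of half-disk e, so
    that this half-disk is 0 <= t <= pi and its counterclockwise end is t = pi
    on either side. *)
Definition sector e r t : R[i] := (sg e * r)%:C * cis t.

Lemma side_sign_sqr e : sg e * sg e = 1.
Proof. by case: e; rewrite /side_sign/= ?mulr1// mulrNN mulr1. Qed.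

Lemma Re_sector e r t : sg e * complex.Re (sector e r t) = r * cos t.
Proof. by rewrite /= !mul0r subr0 !mulrA side_sign_sqr mul1r. Qed.

Lemma Im_sector e r t : sg e * complex.Im (sector e r t) = r * sin t.
Proof. by rewrite /= !mul0r addr0 !mulrA side_sign_sqr mul1r. Qed.

Lemma normc_sector e r t : 0 <= r -> normc (sector e r t) = r.
Proof.
move=> r0; rewrite /sector normcM normc_cis mulr1 /= expr0n addr0 sqrtr_sqr.
rewrite normrM (ger0_norm r0).
by case: e; rewrite /side_sign/= ?normrN1 ?normr1 mul1r.
Qed.

Lemma half_disk_sector e r t : 0 <= r <= 1 -> 0 <= t <= pi ->
  half_disk e (sector e r t).
Proof.
move=> /andP[r0 r1] tpi; apply/half_diskE; rewrite normc_sector// Im_sector.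
by rewrite mulr_ge0// sin_ge0_pi.
Qed.

Lemma sector_shift e r t : sector (other_side e) r t = sector e r (t + pi).
Proof.
rewrite /sector /cis /= cosDpi sinDpi side_sign_other.
by congr (_ +i* _); ring.
Qed.

Lemma half_twist_sector e r t : 0 <= r ->
  half_twist_fun (sector e r t) = sector e r (t + twist_angle r).
Proof.
by move=> r0; rewrite /half_twist_fun normc_sector// /sector -mulrA -cisD.
Qed.

Lemma conjc_sector e r t :
  conjc (sector e r t) = sector (other_side e) r (pi - t).
Proof.
rewrite sector_shift /sector /cis /= cosDpi sinDpi [pi - t]addrC.
rewrite cosDpi sinDpi cosN sinN.
by congr (_ +i* _); ring.
Qed.

Lemma sectorP e z : half_disk e z ->
  exists r t, [/\ 0 <= r <= 1, 0 <= t <= pi & z = sector e r t].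
Proof.
move=> /half_diskE; have pi0 := pi_gt0 R.
have n0 : 0 <= normc z by case: z => x y; exact: sqrtr_ge0.
have [->|zn0] := eqVneq z 0.
  move=> _; exists 0, 0; rewrite lexx ler01 ltW//; split=> //.
  by rewrite /sector mulr0 mul0r.
have r0 : 0 < normc z.
  by rewrite lt_neqAle n0 andbT eq_sym; apply: contraNneq zn0 => /eq0_normc ->.
move=> [z1 zim].
pose c := sg e * complex.Re z / normc z.
pose d := sg e * complex.Im z / normc z.
have d0 : 0 <= d by rewrite divr_ge0.
have zz : complex.Re z ^+ 2 + complex.Im z ^+ 2 = normc z ^+ 2.
  case: z {zn0 z1 zim c d d0 n0 r0} => x y /=.
  by rewrite sqr_sqrtr// addr_ge0// sqr_ge0.
have cd : c ^+ 2 + d ^+ 2 = 1.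
  transitivity
      (sg e * sg e * (complex.Re z ^+ 2 + complex.Im z ^+ 2) / normc z ^+ 2).
    by rewrite /c /d; field; rewrite gt_eqF.
  by rewrite side_sign_sqr zz mul1r divff// expf_neq0// gt_eqF.
have c1 : -1 <= c <= 1 by apply/andP; split; nra.
exists (normc z), (acos c); rewrite n0 z1 acos_ge0// acos_lepi//; split=> //.
rewrite /sector /cis acosK ?in_itv//= sin_acos// -cd addrC addKr sqrtr_sqr.
rewrite ger0_norm//.
case: z zn0 z1 zim @c @d d0 zz cd c1 n0 r0 => x y ? ? ? c d ? ? ? ? ? r0.
rewrite /c /d; set r := normc _ in r0 *.
by congr (_ +i* _) => /=; rewrite !mul0r ?subr0 ?addr0 mulrACA !mulrA
  side_sign_sqr mul1r; field; rewrite gt_eqF.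
Qed.

(** The points of half-disk e that the twist brings exactly to the end of that
    half-disk are those with t = pi - twist_angle r, so this number is the value
    of r cos t there.  Comparing abscissas instead of angles turns the two sides
    of that curve into closed conditions given by continuous functions. *)
Definition cut_level z : R := - (normc z * cos (twist_angle (normc z))).

Definition crosses e z : bool := sg e * complex.Re z <= cut_level z.

Definition stays e z : bool := cut_level z <= sg e * complex.Re z.

(** At r = 0, where the left side does not depend on t, both sides are true,
    since twist_angle 0 = pi. *)
Lemma crosses_sector e r t : 0 <= r <= 1 -> 0 <= t <= pi ->
  crosses e (sector e r t) = (pi <= t + twist_angle r).
Proof.
move=> /andP[r0 r1] tpi; have /andP[f0 f1] := twist_angle_itv r1.
have pi0 := pi_gt0 R.
rewrite /crosses /cut_level normc_sector// Re_sector.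
move: r0; rewrite le_eqVlt => /predU1P[<-|r0].
  rewrite twist_angle_inner; last by lra.
  by rewrite !mul0r oppr0 lexx lerDr; case/andP: tpi => ->.
rewrite -mulrN ler_pM2l// -(cosN (twist_angle r)) -cosDpi [- _ + pi]addrC.
rewrite leNgt ltr_cos ?in_itv//=; last by lra.
by rewrite -leNgt lerBlDr.
Qed.

Lemma stays_sector e r t : 0 < r <= 1 -> 0 <= t <= pi ->
  stays e (sector e r t) = (t + twist_angle r <= pi).
Proof.
move=> /andP[r0 r1] tpi; have /andP[f0 f1] := twist_angle_itv r1.
rewrite /stays /cut_level normc_sector ?(ltW r0)// Re_sector.
rewrite -mulrN ler_pM2l// -(cosN (twist_angle r)) -cosDpi [- _ + pi]addrC.
rewrite leNgt ltr_cos ?in_itv//=; last by lra.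
by rewrite -leNgt lerBrDr.
Qed.

(** * The lifted twist on a half-disk *)

Definition twist_chart s e z : X :=
  if crosses e z then chart (across0 s) (other_side e) (half_twist_fun z)
  else chart s e (half_twist_fun z).

Lemma twist_chart_sector s e r t : 0 <= r <= 1 -> 0 <= t <= pi ->
  twist_chart s e (sector e r t) =
  if pi <= t + twist_angle r then
    chart (across0 s) (other_side e)
      (sector (other_side e) r (t + twist_angle r - pi))
  else chart s e (sector e r (t + twist_angle r)).
Proof.
move=> r01 tpi; rewrite /twist_chart crosses_sector//.
have /andP[r0 _] := r01.
by rewrite half_twist_sector// sector_shift subrK.
Qed.

Lemma on_cut_sector e r : 2^-1 <= r <= 1 -> on_cut e (sector e r pi).
Proof.
move=> r01; split.
  by rewrite /= sinpi cospi !mulr0 mul0r addr0.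
by rewrite Re_sector cospi mulrN1 opprK.
Qed.

Lemma on_cutP e z : on_cut e z ->
  exists2 r, 2^-1 <= r <= 1 & z = sector e r pi.
Proof.
case: z => x y [/= -> xr]; exists (- (sg e * x)) => //.
rewrite /sector /cis cospi sinpi; congr (_ +i* _) => /=; last by ring.
by rewrite mul0r subr0 mulrN1 mulrN opprK mulrA side_sign_sqr mul1r.
Qed.

Lemma twist_chart_inner s e z : normc z <= 3 / 4 ->
  twist_chart s e z = chart (across0 s) (other_side e) (- z).
Proof.
move=> z34; have z0 : 0 <= normc z by case: (z) => x y; exact: sqrtr_ge0.
rewrite /twist_chart /crosses /cut_level /half_twist_fun twist_angle_inner//.
rewrite cospi mulrN1 opprK ifT.
  rewrite (_ : cis pi = -1) ?mulrN1//.
  by rewrite /cis cospi sinpi; apply/eqP; rewrite eq_complex/= oppr0 !eqxx.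
have : `|complex.Re z| <= normc z.
  by case: (z) => x y /=; rewrite -sqrtr_sqr ler_wsqrtr// lerDl sqr_ge0.
by rewrite ler_norml /side_sign; case: e => /=; lra.
Qed.

Lemma on_arc1_normc z : on_arc1 z -> normc z <= 2^-1.
Proof. by move=> [z0 z1]; rewrite normc_Im0. Qed.

Lemma on_arc1N z : on_arc1 z -> on_arc1 (- z).
Proof. by case: z => x y [/= -> x1]; split; rewrite /= ?oppr0 ?normrN. Qed.

Lemma twist_chart_arc1 s z : on_arc1 z ->
  twist_chart s upper z = twist_chart s lower z.
Proof.
move=> z1; have zn := on_arc1_normc z1.
rewrite !twist_chart_inner; [|lra..].
by apply: chart_arc1; exact: on_arc1N.
Qed.

(** The point is at the end t = pi of half-disk e, equivalently at the start
    t = 0 of the next one.  Seen from e it has to cross.  Seen from the next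
    half-disk it turns inside it, with the same result, unless its angle is pi;
    then it is carried to the end of that half-disk, where chart_cut identifies
    the names given to it by the two formulas. *)
Lemma twist_chart_cut s e z : on_cut e z ->
  twist_chart s e z = twist_chart (across0 s) (other_side e) z.
Proof.
move=> /on_cutP[r r01 ->]; have pi0 := pi_gt0 R.
have rr : 0 <= r <= 1 by lra.
have /twist_angle_itv/andP[f0 f1] : r <= 1 by lra.
rewrite twist_chart_sector//; last by lra.
rewrite lerDl f0 addrAC subrr add0r.
rewrite -[pi in RHS]add0r -sector_shift twist_chart_sector//; last by lra.
rewrite add0r; case: ifPn => // pif.
have -> : twist_angle r = pi by lra.
rewrite subrr chart_cut; last exact: on_cut_sector.
by rewrite [in RHS]sector_shift add0r.
Qed.

(** * Continuity of the lifted twist *)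

Definition twist : X -> X := cover_map twist_chart.

Lemma twistE s e z : half_disk e z -> twist (chart s e z) = twist_chart s e z.
Proof. exact: cover_mapE twist_chart_arc1 twist_chart_cut s e z. Qed.

Lemma closed_le_fun (f g : R[i] -> R) : continuous f -> continuous g ->
  closed [set z | f z <= g z].
Proof.
move=> cf cg.
rewrite (_ : mkset _ = (fun z => g z - f z) @^-1` [set x | 0 <= x]).
  apply: closed_comp; last exact: closed_ge.
  by move=> z _; apply: (@continuousB _ R^o _ g f); [exact: cg|exact: cf].
by apply/funext => z /=; rewrite subr_ge0.
Qed.

Lemma half_disk_closed e : closed (@half_disk R e).
Proof.
rewrite (_ : half_disk e =
  [set z | normc z <= 1] `&` [set z | 0 <= sg e * complex.Im z]).
  apply: closedI; apply: closed_le_fun.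
  - exact: normc_continuous.
  - exact: cst_continuous.
  - exact: cst_continuous.
  - by move=> z; apply: continuousM;
      [exact: cst_continuous|exact: Im_continuous].
by apply/seteqP; split=> z /half_diskE.
Qed.

Lemma cut_level_continuous : continuous cut_level.
Proof.
move=> z; apply: (@continuousN _ R^o _
  (fun z => normc z * cos (twist_angle (normc z)))).
apply: continuousM; first exact: normc_continuous.
apply: continuous_comp; last exact: continuous_cos.
by apply: continuous_comp;
  [exact: normc_continuous|exact: twist_angle_continuous].
Qed.

Lemma side_Re_continuous e : continuous (fun z : R[i] => sg e * complex.Re z).
Proof.
by move=> z; apply: continuousM; [exact: cst_continuous|exact: Re_continuous].
Qed.

Lemma crosses_half_disk e z : half_disk e z -> crosses e z ->
  half_disk (other_side e) (half_twist_fun z).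
Proof.
move=> hz; have [r [t [r01 tpi ze]]] := sectorP hz; subst z.
rewrite crosses_sector// => cr.
have /twist_angle_itv/andP[f0 f1] : r <= 1 by lra.
rewrite half_twist_sector; last by lra.
rewrite -[_ + _](subrK pi) -sector_shift.
by apply: half_disk_sector; lra.
Qed.

Lemma stays_half_disk e z : half_disk e z -> 3 / 4 <= normc z /\ stays e z ->
  half_disk e (half_twist_fun z).
Proof.
move=> hz; have [r [t [r01 tpi ze]]] := sectorP hz; subst z.
rewrite normc_sector; last by lra.
move=> [r34]; rewrite stays_sector//; last by lra.
have /twist_angle_itv/andP[f0 f1] : r <= 1 by lra.
by move=> st; rewrite half_twist_sector; [apply: half_disk_sector; lra|lra].
Qed.

(** In the disk of radius 3/4 the angle is pi and every point crosses; this is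
    why the formula for the points that stay is only needed away from arc 1. *)
Lemma not_crosses e z : half_disk e z -> ~~ crosses e z ->
  3 / 4 <= normc z /\ stays e z.
Proof.
move=> hz ncz; split; last by apply: ltW; rewrite ltNge.
have [r [t [r01 tpi ze]]] := sectorP hz; subst z.
move: ncz; rewrite crosses_sector// normc_sector; last by lra.
by apply: contraNle => /ltW/twist_angle_inner ->; lra.
Qed.

(** A point that both stays and crosses arrives on a cut, as its radius exceeds
    1/2; there the two formulas are identified by the gluing. *)
Lemma twist_chart_stays s e z :
  half_disk e z -> 3 / 4 <= normc z /\ stays e z ->
  twist_chart s e z = chart s e (half_twist_fun z).
Proof.
move=> hz; have [r [t [r01 tpi ze]]] := sectorP hz; subst z.
rewrite normc_sector; last by lra.
move=> [r34]; rewrite stays_sector//; last by lra.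
move=> st; rewrite twist_chart_sector// half_twist_sector; last by lra.
case: ifPn => // cr; have -> : t + twist_angle r = pi by lra.
rewrite subrr [RHS]chart_cut; last by apply: on_cut_sector; lra.
by rewrite sector_shift add0r.
Qed.

Lemma twist_chart_continuous s e :
  {within half_disk e, continuous (twist_chart s e)}.
Proof.
(* The bound on the radius in P matters: at t = 0 the points of radius below
   1/2 satisfy stays as well, but they arrive on arc 1, where the two formulas
   give different sheets. *)
pose Q := half_disk e `&` [set z | crosses e z].
pose P := half_disk e `&` ([set z | 3 / 4 <= normc z] `&` [set z | stays e z]).
have PQ : half_disk e = P `|` Q.
  apply/seteqP; split=> z; last by case=> -[].
  move=> hz; have [cz|ncz] := boolP (crosses e z); first by right.
  by left; split=> //; exact: not_crosses.
have cQ : closed Q.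
  by apply: closedI; [exact: half_disk_closed|apply: closed_le_fun;
    [exact: side_Re_continuous|exact: cut_level_continuous]].
have cP : closed P.
  apply: closedI; first exact: half_disk_closed.
  apply: closedI; apply: closed_le_fun.
  - exact: cst_continuous.
  - exact: normc_continuous.
  - exact: cut_level_continuous.
  - exact: side_Re_continuous.
have onP : {in P, (fun z => chart s e (half_twist_fun z)) =1 twist_chart s e}.
  by move=> z /set_mem[hz stz]; rewrite twist_chart_stays.
have onQ : {in Q, (fun z => chart (across0 s) (other_side e) (half_twist_fun z))
    =1 twist_chart s e}.
  by move=> z /set_mem[_ /= cz]; rewrite /twist_chart cz.
rewrite PQ; apply: withinU_continuous => //.
  apply: subspace_eq_continuous onP _.
  apply: chart_comp_continuous; first exact: half_twist_fun_continuous.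
  by move=> z []; exact: stays_half_disk.
apply: subspace_eq_continuous onQ _.
apply: chart_comp_continuous; first exact: half_twist_fun_continuous.
by move=> z []; exact: crosses_half_disk.
Qed.

Lemma twist_continuous : continuous twist.
Proof.
apply: cover_map_continuous; [exact: twist_chart_arc1|exact: twist_chart_cut|].
exact: twist_chart_continuous.
Qed.

(** * The inverse of the lifted twist *)

(** A lift of complex conjugation.  Conjugation by it turns the lifted twist,
    which rotates counterclockwise, into its inverse. *)
Definition mirror_chart s e z : X := chart (swap_bc s) (other_side e) (conjc z).

Lemma half_disk_conjc e z : half_disk e z -> half_disk (other_side e) (conjc z).
Proof.
move=> /half_diskE[z1 z0]; apply/half_diskE; rewrite side_sign_other.
by case: z z1 z0 => x y /=; rewrite sqrrN mulrNN.
Qed.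

Lemma conjc_Im0 z : complex.Im z = 0 -> conjc z = z.
Proof. by case: z => x y /= ->; rewrite oppr0. Qed.

Lemma mirror_chart_arc1 s z : on_arc1 z ->
  mirror_chart s upper z = mirror_chart s lower z.
Proof.
by move=> z1; rewrite /mirror_chart conjc_Im0; [exact: chart_arc1|case: z1].
Qed.

Lemma mirror_chart_cut s e z : on_cut e z ->
  mirror_chart s e z = mirror_chart (across0 s) (other_side e) z.
Proof.
move=> ze; rewrite /mirror_chart conjc_Im0; last by case: ze.
by rewrite other_sideK [RHS]chart_cut// across0_swap.
Qed.

Definition mirror : X -> X := cover_map mirror_chart.

Lemma mirrorE s e z : half_disk e z ->
  mirror (chart s e z) = chart (swap_bc s) (other_side e) (conjc z).
Proof. exact: cover_mapE mirror_chart_arc1 mirror_chart_cut s e z. Qed.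

Lemma mirror_continuous : continuous mirror.
Proof.
apply: cover_map_continuous;
  [exact: mirror_chart_arc1|exact: mirror_chart_cut|move=> s e].
apply: chart_comp_continuous; first exact: conjc_continuous.
by move=> z; exact: half_disk_conjc.
Qed.

Lemma mirrorK : involutive mirror.
Proof.
move=> x; have [s [e [z [hz ->]]]] := coverP x.
rewrite !mirrorE//; last exact: half_disk_conjc.
by rewrite swap_bcK other_sideK conjcK.
Qed.

(** In polar coordinates the composite sends the angle t to pi - (t + phi) on
    the other side when no cut is passed, and to 2 pi - (t + phi) on the same
    side otherwise.  Applying it twice gives t back, with one subtlety: a point
    that starts at t = 0 and passes no cut is reflected to a point that passes
    one, so it comes back in the neighbouring half-disk, as the other name of
    the same point of the cut. *)
Lemma mirror_twistK : involutive (mirror \o twist).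
Proof.
move=> x; have [s [e [z [hz ->]]]] := coverP x; rewrite /=.
have [r [t [r01 tpi ze]]] := sectorP hz; subst z; have pi0 := pi_gt0 R.
have /twist_angle_itv/andP[f0 f1] : r <= 1 by lra.
rewrite twistE// twist_chart_sector//; case: ifPn => cr.
  rewrite mirrorE; last by apply: half_disk_sector => //; lra.
  rewrite conjc_sector other_sideK.
  rewrite twistE; last by apply: half_disk_sector => //; lra.
  rewrite twist_chart_sector//; last by lra.
  rewrite ifT; last by lra.
  rewrite mirrorE; last by apply: half_disk_sector => //; lra.
  rewrite conjc_sector other_sideK across0_swap swap_bcK.
  by congr (chart _ _ (sector _ _ _)); ring.
rewrite mirrorE; last by apply: half_disk_sector => //; lra.
rewrite conjc_sector twistE; last by apply: half_disk_sector => //; lra.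
rewrite twist_chart_sector//; last by lra.
case: ifPn => cr'.
  (* The exceptional point lies on a cut: in the inner disk it would cross. *)
  have t0 : t = 0 by lra.
  have r34 : 3 / 4 < r.
    by rewrite ltNge; apply: contra cr => /twist_angle_inner ->; lra.
  rewrite mirrorE; last by apply: half_disk_sector => //; lra.
  rewrite conjc_sector other_sideK.
  rewrite (_ : pi - _ = pi); last by rewrite t0; ring.
  rewrite chart_cut; last by apply: on_cut_sector; lra.
  rewrite other_sideK across0_swap swap_bcK t0; congr chart.
  by rewrite -[e in RHS]other_sideK [in RHS]sector_shift add0r.
rewrite mirrorE; last by apply: half_disk_sector => //; lra.
rewrite conjc_sector other_sideK swap_bcK.
by congr (chart _ _ (sector _ _ _)); ring.
Qed.

(** * The lift and its values on the boundary and on arc 1 *)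

Lemma twist_is_lift : is_lift (@half_twist R) twist.
Proof.
split.
  split; first exact: twist_continuous.
  exists (mirror \o twist \o mirror); split.
  - move=> x; apply: continuous_comp; first exact: mirror_continuous.
    by apply: continuous_comp;
      [exact: twist_continuous|exact: mirror_continuous].
  - by move=> x; exact: mirror_twistK.
  - move=> x /=.
    by rewrite -[RHS]mirrorK -[in RHS](mirror_twistK (mirror x)) /= mirrorK.
apply/funext => x; apply: val_inj.
rewrite -[RHS]/(half_twist_fun (val (cover_proj x))) /comp.
have [s [e [z [hz ->]]]] := coverP x.
rewrite twistE// cover_proj_chart// /twist_chart; case: ifPn => cz.
  by rewrite cover_proj_chart//; exact: crosses_half_disk.
by rewrite cover_proj_chart//; apply: stays_half_disk => //; exact: not_crosses.
Qed.

(** On the unit circle the angle is 0.  Only the point t = pi crosses, and its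
    image is its other name across the cut. *)
Lemma twist_boundary (x : X) : cover_boundary x -> twist x = x.
Proof.
have [s [e [z [hz ->]]]] := coverP x; rewrite /cover_boundary/=.
have /= -> := cover_proj_chart s hz; rewrite twistE//.
have [r [t [r01 tpi ze]]] := sectorP hz; subst z.
rewrite normE normc_sector; last by lra.
move=> /(congr1 (@complex.Re R))/= r1; subst r.
rewrite twist_chart_sector// twist_angle1 addr0; case: ifPn => // pit.
have -> : t = pi by lra.
rewrite subrr sector_shift add0r -chart_cut//.
by apply: on_cut_sector; lra.
Qed.

(** Arc 1 lies in the inner disk, which turns by pi into the next sheet. *)
Lemma twist_arc1_lift s :
  twist \o arc1_lift s = reverse_path (arc1_lift (across0 s)).
Proof.
apply/funext => t /=; rewrite /reverse_path /arc1_lift -!chartE.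
have := set_valP t; rewrite /= in_itv /= => /andP[t0 t1].
have segE u : seg (p1 R) (p2 R) u = (u - 2^-1)%:C.
  by rewrite /seg /p1 /p2 -rmorphB -rmorphM -rmorphD; congr (_%:C); lra.
have t_arc1 : on_arc1 (seg (p1 R) (p2 R) (val t)).
  by rewrite segE; split=> //=; rewrite ler_norml; lra.
rewrite twistE; last exact: on_arc1_half_disk.
rewrite twist_chart_inner; last by have := on_arc1_normc t_arc1; lra.
rewrite (chart_arc1 _ _ upper); last exact: on_arc1N.
by rewrite !segE -rmorphN; congr (chart _ _ _%:C); rewrite /=; lra.
Qed.

End Twist.

Theorem theorem3p1 (R : realType) :
  exists twist : branched_cover R -> branched_cover R,
    [/\ is_lift (@half_twist R) twist,
        (forall x : branched_cover R, cover_boundary x -> twist x = x),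
        twist \o arc1_lift sheet_a = reverse_path (arc1_lift sheet_b),
        twist \o arc1_lift sheet_b = reverse_path (arc1_lift sheet_c) &
        twist \o arc1_lift sheet_c = reverse_path (arc1_lift sheet_a)].
Proof.
exists (@twist R); split; first exact: twist_is_lift.
- exact: twist_boundary.
- exact: twist_arc1_lift sheet_a.
- exact: twist_arc1_lift sheet_b.
- exact: twist_arc1_lift sheet_c.
Qed.
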